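(* Every triangle-tree is common.
   Context: For a graph $H$ and a graphon $W$ (a measurable symmetric function $W:[0,1]^2\to[0,1]$), let $t_H(W)=\int_{[0,1]^{V(H)}}\prod_{uv\in E(H)}W(x_u,x_v)\,dx$ and $m_H(W)=t_H(W)+t_H(1-W)$. A graph $H$ is common if $m_H(W)\ge 2^{1-e(H)}$ for every graphon $W$ (equivalently, the asymptotic minimum over 2-edge-colourings of $K_n$ of the number of monochromatic labelled copies of $H$, divided by $n^{v(H)}$, equals $2^{1-e(H)}$, the value achieved by a uniformly random colouring). Triangle-trees are defined recursively: $K_3$ is a triangle-tree, and if $H$ is a triangle-tree then the graph obtained from $H$ by adding a new triangle that shares with $H$ exactly one vertex, or exactly one edge (together with its two endpoints), and is otherwise vertex-disjoint from $H$, is a triangle-tree. *)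

(* Defs.v *)
From HB Require Import structures.
From mathcomp Require Import all_boot all_order all_algebra all_fingroup.
From mathcomp Require Import all_classical all_reals all_analysis.
Set Implicit Arguments. Unset Strict Implicit. Unset Printing Implicit Defensive.
Import Order.TTheory GRing.Theory Num.Theory.
Local Open Scope ring_scope.
Local Open Scope classical_set_scope.

(** Finite simple graphs on the vertex set 'I_n are given by an adjacency
    relation [g : rel 'I_n]; simplicity (symmetry, irreflexivity) holds for
    every graph generated by [triangle_tree] below. *)

Definition edges n (g : rel 'I_n) : {set 'I_n * 'I_n} :=
  [set p : 'I_n * 'I_n | (val p.1 < val p.2)%N && g p.1 p.2].

Definition e_count n (g : rel 'I_n) : nat := #|edges g|.

Definition gnat n (g : rel 'I_n) (a b : nat) : bool :=
  match @insub nat (fun k => (k < n)%N) 'I_n a,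
        @insub nat (fun k => (k < n)%N) 'I_n b with
  | Some i, Some j => g i j
  | _, _ => false
  end.

Definition tri (a b c x y : nat) : bool :=
  [&& x != y, x \in [:: a; b; c] & y \in [:: a; b; c]].

Definition add_tri_vertex n (g : rel 'I_n) (v : 'I_n) : rel 'I_n.+2 :=
  fun i j => gnat g i j || tri v n n.+1 i j.

Definition add_tri_edge n (g : rel 'I_n) (u v : 'I_n) : rel 'I_n.+1 :=
  fun i j => gnat g i j || tri u v n i j.

Inductive triangle_tree : forall n, rel 'I_n -> Prop :=
| tt_base : triangle_tree (fun i j : 'I_3 => i != j)
| tt_vertex n (g : rel 'I_n) (v : 'I_n) :
    triangle_tree g -> triangle_tree (add_tri_vertex g v)
| tt_edge n (g : rel 'I_n) (u v : 'I_n) :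
    triangle_tree g -> g u v -> triangle_tree (add_tri_edge g u v)
| tt_relabel n (g : rel 'I_n) (s : {perm 'I_n}) :
    triangle_tree g -> triangle_tree (fun i j => g (s i) (s j)).

(** Graphons: measurable symmetric functions into [0,1]; we take them defined
    on R x R (only the values on [0,1]^2 matter). *)
Definition graphon (R : realType) (W : R -> R -> R) : Prop :=
  [/\ measurable_fun setT (fun p : R * R => W p.1 p.2),
      (forall x y, W x y = W y x) &
      (forall x y, 0 <= W x y <= 1)].

Definition scons (R : Type) (x : R) (y : nat -> R) : nat -> R :=
  fun k => if k is k'.+1 then y k' else x.

(** Iterated Lebesgue integral over [0,1]^n of a function of the first n
    coordinates (coordinate 0 outermost); for non-negative measurable
    integrands this equals the integral w.r.t. Lebesgue measure on [0,1]^n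
    by Tonelli. *)
Fixpoint iint (R : realType) (n : nat) (f : (nat -> R) -> \bar R) : \bar R :=
  match n with
  | 0 => f (fun _ => 0)
  | n'.+1 => (\int[@lebesgue_measure R]_(x in `[0%R, 1%R]%classic)
                 iint n' (fun y => f (scons x y)))%E
  end.

Definition hom_density (R : realType) n (g : rel 'I_n) (W : R -> R -> R)
  : \bar R :=
  iint n (fun x => (\prod_(p in edges g) W (x (val p.1)) (x (val p.2)))%:E).

Definition m_H (R : realType) n (g : rel 'I_n) (W : R -> R -> R) : \bar R :=
  (hom_density g W + hom_density g (fun x y => (1 - W x y)%R))%E.

Definition common (R : realType) n (g : rel 'I_n) : Prop :=
  forall W : R -> R -> R, graphon W ->
    (((2 : R) / 2 ^+ e_count g)%:E <= m_H g W)%E.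

(* Main.v *)
Require Import Defs.
From mathcomp Require Import all_boot all_order all_algebra all_fingroup.
From mathcomp Require Import all_classical all_reals all_analysis.
From mathcomp Require Import measurable_realfun ring lra zify.
Set Implicit Arguments. Unset Strict Implicit. Unset Printing Implicit Defensive.
Import Order.TTheory GRing.Theory Num.Theory.
Local Open Scope ring_scope.
Local Open Scope classical_set_scope.

(** Glue independent copies of the random triangle with density proportional to
    W(x,y) W(y,z) W(x,z), conditionally on the shared vertex or edge.  Every edge
    of the resulting random copy of the triangle-tree H has the edge marginal of
    the triangle measure, so t_H(W) is the total mass of the glued measure times
    the average of a product of factors alpha: 8 times the vertex marginal at a
    glued vertex, 4 times the codegree at a glued edge (up to the constant
    8^k / 2^e for k gluings, e of them along an edge).  From
    prod alpha >= exp (sum (1 - 1/alpha)) >= 1 + sum (1 - 1/alpha)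
    and the fact that 1/alpha integrates to 1/8, resp. t_{K_2}(W)/4, one gets
    8^k / 2^e t_H(W) >= (k+1) t_{K_3}(W) - (k-e)/8 - e/4 t_{K_2}(W).
    This bound is linear in W's densities: adding it for W and 1 - W, Goodman's
    inequality t_{K_3}(W) + t_{K_3}(1-W) >= 1/4 gives exactly the claim.
    The divisions require W to be bounded away from 0; a general W is replaced by
    (1-d) W + d/2, an operation commuting with W |-> 1 - W, and d tends to 0. *)

(** * Averages and iterated integrals of bounded measurable functions *)

(** The uniform law on [0,1] is a probability on all of R, so integrals need no domain and constants
    are their own averages; [fine] loses nothing for bounded measurable integrands. *)
Definition avg (R : realType) (f : R -> R) : R :=
  fine (\int[uniform_prob (@ltr01 R)]_t (f t)%:E)%E.

(* Measurability for the product sigma-algebra on the sequences [nat -> R], stated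
   through measurable families of coordinates. *)
Definition env_measurable (R : realType) (F : (nat -> R) -> R) : Prop :=
  forall d (T : measurableType d) (c : nat -> T -> R),
    (forall k, measurable_fun setT (c k)) ->
    measurable_fun setT (fun t => F (fun k => c k t)).

Definition nice (R : realType) (F : (nat -> R) -> R) : Prop :=
  env_measurable F /\ exists M, forall x, `|F x| <= M.

Definition upd (R : Type) (x : nat -> R) (i : nat) (t : R) : nat -> R :=
  fun k => if k == i then t else x k.

(** Integrating out one coordinate returns a function on the same sequence space, so that Fubini
    becomes commutation of operators. *)
Definition integrate (R : realType) (i : nat) (F : (nat -> R) -> R) :
  (nat -> R) -> R := fun x => avg (fun t => F (upd x i t)).

Section Average.
Variable R : realType.
Implicit Types f g : R -> R.
Local Notation P := (uniform_prob (@ltr01 R)).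

Definition bmeas d (T : measurableType d) (f : T -> R) :=
  measurable_fun setT f /\ exists M : R, forall x, `|f x| <= M.

Lemma bmeas_cst d (T : measurableType d) (k : R) : bmeas (fun _ : T => k).
Proof. by split=> //; exists `|k|. Qed.

Lemma bmeasD d (T : measurableType d) (f g : T -> R) :
  bmeas f -> bmeas g -> bmeas (fun t => f t + g t).
Proof.
move=> [mf [M fM]] [mg [N gN]]; split; first exact: measurable_funD.
by exists (M + N) => t; rewrite (le_trans (ler_normD _ _)) ?lerD.
Qed.

Lemma bmeasM d (T : measurableType d) (f g : T -> R) :
  bmeas f -> bmeas g -> bmeas (fun t => f t * g t).
Proof.
move=> [mf [M fM]] [mg [N gN]]; split; first exact: measurable_funM.
by exists (M * N) => t; rewrite normrM ler_pM.
Qed.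

Lemma bmeas_integrable f : bmeas f -> P.-integrable setT (EFin \o f).
Proof.
move=> [mf [M fM]]; apply: measurable_bounded_integrable => //.
  by rewrite [X in (X < _)%E]probability_setT ltry.
exists M; split; first by rewrite num_real.
by move=> N MN x _; rewrite /= (le_trans (fM x)) // ltW.
Qed.

Lemma avgE f : bmeas f -> ((avg f)%:E = \int[P]_t (f t)%:E)%E.
Proof.
by move=> /bmeas_integrable fi; rewrite fineK //; exact: integrable_fin_num.
Qed.

Lemma avgD f g : bmeas f -> bmeas g ->
  avg (fun t => f t + g t) = avg f + avg g.
Proof.
by move=> bf bg; apply: (@RintegralD _ _ _ P); rewrite //; exact: bmeas_integrable.
Qed.

Lemma avgZ k f : bmeas f -> avg (fun t => k * f t) = k * avg f.
Proof.
by move=> bf; apply: (@RintegralZl _ _ _ P); rewrite //; exact: bmeas_integrable.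
Qed.

Lemma avg_cst (k : R) : avg (fun=> k) = k.
Proof.
have := @Rintegral_cst _ _ _ P setT measurableT k.
by rewrite [X in _ * fine X]probability_setT /= mulr1.
Qed.

Lemma le_avg f g : bmeas f -> bmeas g -> (forall t, f t <= g t) ->
  avg f <= avg g.
Proof.
by move=> bf bg fg; apply: (@le_Rintegral _ _ _ P) => //; exact: bmeas_integrable.
Qed.

Lemma bmeas_section d (T : measurableType d) (F : T * R -> R) x :
  bmeas F -> bmeas (fun t => F (x, t)).
Proof.
by move=> [mF [M FM]]; split; [exact: measurableT_comp|exists M].
Qed.

Lemma avg_bound f M : bmeas f -> (forall t, `|f t| <= M) -> `|avg f| <= M.
Proof.
move=> bf fM; rewrite ler_norml -{1}(avg_cst (- M)) -{2}(avg_cst M).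
have fMt t : (- M <= f t) && (f t <= M) by rewrite -ler_norml.
apply/andP; split; apply: le_avg => [||t]; try exact: bmeas_cst; try exact: bf.
  by case/andP: (fMt t).
by case/andP: (fMt t).
Qed.

Lemma bmeas_avg d (T : measurableType d) (F : T * R -> R) :
  bmeas F -> bmeas (fun x => avg (fun t => F (x, t))).
Proof.
move=> bF; have [mF [M FM]] := bF; split; last first.
  by exists M => x; apply: avg_bound => //; exact: bmeas_section.
have bs x := bmeas_section x bF.
(* Tonelli's measurability statement needs a nonnegative integrand, so the bound [M] is added before
   averaging and subtracted afterwards. *)
suff: measurable_fun setT
    (fun x => fine (\int[P]_t (F (x, t) + M)%:E)%E + (- M)).
  apply: eq_measurable_fun => x _.
  by rewrite [X in X + _](avgD (bs x) (bmeas_cst _ M)) avg_cst addrK.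
apply: measurable_funD => //.
apply: measurableT_comp; first exact: fine_measurable.
apply: (@measurable_fun_fubini_tonelli_F _ _ _ _ _ P
  (fun z => (F z + M)%:E)).
  by apply/measurable_EFinP; apply: measurable_funD.
move=> z; rewrite lee_fin -lerBlDr sub0r.
by move: (FM z); rewrite ler_norml => /andP[].
Qed.

Lemma avg_swap (F : R * R -> R) : bmeas F ->
  avg (fun s => avg (fun t => F (s, t))) =
  avg (fun t => avg (fun s => F (s, t))).
Proof.
move=> bF; have [mF [M FM]] := bF.
pose G (z : R * R) := F (z.2, z.1).
have bG : bmeas G.
  split; last by exists M => z; exact: FM.
  by apply: measurableT_comp => //; exact: measurable_fun_pair.
have Fi : (P \x P)%E.-integrable setT (EFin \o F).
  apply: measurable_bounded_integrable => //.
    rewrite -setXTT [X in (X < _)%E]product_measure1E //.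
    by rewrite [X in (X * _)%E]probability_setT mul1e [X in (X < _)%E]probability_setT ltry.
  exists M; split; first by rewrite num_real.
  by move=> N MN x _; rewrite /= (le_trans (FM x)) // ltW.
have E1 : (\int[P]_s \int[P]_t (F (s, t))%:E =
           \int[P]_s (avg (fun t => F (s, t)))%:E)%E.
  by apply: eq_integral => s _; rewrite (avgE (bmeas_section s bF)).
have E2 : (\int[P]_t \int[P]_s (F (s, t))%:E =
           \int[P]_t (avg (fun s => F (s, t)))%:E)%E.
  by apply: eq_integral => t _; rewrite (avgE (bmeas_section t bG)).
have E := etrans (esym E1) (etrans (Fubini Fi) E2).
exact: (f_equal fine E).
Qed.

End Average.

(** * Bounded measurable functions of a sequence and their iterated averages *)

Definition integrate_seq (R : realType) (l : seq nat) (F : (nat -> R) -> R) :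
  (nat -> R) -> R := foldr (@integrate R) F l.

Section Nice.
Variable R : realType.
Implicit Types (F G : (nat -> R) -> R) (W : R -> R -> R).

Lemma env_measurable_comp F (h : nat -> (nat -> R) -> R) :
  env_measurable F -> (forall k, env_measurable (h k)) ->
  env_measurable (fun x => F (h ^~ x)).
Proof. by move=> mF mh d T c mc; apply: mF => k; exact: mh. Qed.

Lemma env_measurable_coord i : env_measurable (fun x : nat -> R => x i).
Proof. by move=> d T c; exact. Qed.

Lemma nice_bmeas F d (T : measurableType d) (c : nat -> T -> R) :
  nice F -> (forall k, measurable_fun setT (c k)) ->
  bmeas (fun t => F (fun k => c k t)).
Proof.
by move=> [mF [M FM]] mc; split; [exact: mF|exists M => t; exact: FM].
Qed.

Lemma nice_comp F (h : nat -> (nat -> R) -> R) :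
  nice F -> (forall k, env_measurable (h k)) -> nice (fun x => F (h ^~ x)).
Proof.
move=> [mF [M FM]] mh; split; first exact: env_measurable_comp.
by exists M => x; exact: FM.
Qed.

Lemma nice_cst (r : R) : nice (fun=> r).
Proof. by split=> //; exists `|r|. Qed.

Lemma niceD F G : nice F -> nice G -> nice (fun x => F x + G x).
Proof.
move=> [mF [M FM]] [mG [N GN]]; split.
  by move=> d T c mc; apply: measurable_funD; [exact: mF|exact: mG].
by exists (M + N) => x; rewrite (le_trans (ler_normD _ _)) ?lerD.
Qed.

Lemma niceM F G : nice F -> nice G -> nice (fun x => F x * G x).
Proof.
move=> [mF [M FM]] [mG [N GN]]; split.
  by move=> d T c mc; apply: measurable_funM; [exact: mF|exact: mG].
by exists (M * N) => x; rewrite normrM ler_pM.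
Qed.

Lemma niceN F : nice F -> nice (fun x => - F x).
Proof.
move=> /(niceM (nice_cst (- 1))); congr nice.
by apply/funext => x; rewrite mulN1r.
Qed.

Lemma niceB F G : nice F -> nice G -> nice (fun x => F x - G x).
Proof. by move=> nF nG; exact: niceD (niceN nG). Qed.

Lemma niceV F (e : R) : 0 < e -> (forall x, e <= F x) -> nice F ->
  nice (fun x => (F x)^-1).
Proof.
move=> e0 eF [mF _]; split.
  move=> d T c mc.
  (* On positive reals inversion is the power -1, and powers are measurable. *)
  have -> : (fun t => (F (fun k => c k t))^-1) =
      @powR R ^~ (- 1) \o (fun t => F (fun k => c k t)).
    by apply/funext => t /=; rewrite powRN powRr1 // (le_trans (ltW e0)).
  by apply: measurableT_comp; [exact: measurable_powR|exact: mF].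
exists e^-1 => x; have F0 : 0 < F x by exact: lt_le_trans (eF x).
by rewrite ger0_norm ?invr_ge0 ?(ltW F0)// lef_pV2.
Qed.

Lemma nice_prod (I : Type) (r : seq I) (p : pred I) (F : I -> (nat -> R) -> R) :
  (forall i, nice (F i)) -> nice (fun x => \prod_(i <- r | p i) F i x).
Proof.
move=> nF; elim: r => [|i r IH].
  rewrite [X in nice X](_ : _ = fun=> 1); first exact: nice_cst.
  by apply/funext => x; rewrite big_nil.
rewrite [X in nice X](_ : _ = fun x => (if p i then F i x else 1) *
    \prod_(i <- r | p i) F i x).
  by apply: niceM => //; case: (p i) => //; exact: nice_cst.
by apply/funext => x; rewrite big_cons; case: (p i); rewrite ?mul1r.
Qed.

(** A function of two variables is read on coordinates 0 and 1, so that one notion of niceness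
    covers every arity. *)
Definition nice_kernel W := nice (fun x => W (x 0%N) (x 1%N)).

Lemma nice_kernelP W (f g : (nat -> R) -> R) : nice_kernel W ->
  env_measurable f -> env_measurable g -> nice (fun x => W (f x) (g x)).
Proof.
move=> nk mf mg.
by apply: (nice_comp (h := fun i => if i is 0%N then f else g) nk) => -[|].
Qed.

Lemma upd_measurable i d (T : measurableType d) (c : nat -> T -> R) (u : T -> R) :
  (forall k, measurable_fun setT (c k)) -> measurable_fun setT u ->
  forall k, measurable_fun setT (fun t => upd (c ^~ t) i (u t) k).
Proof. by move=> mc mu k; rewrite /upd; case: (k == i). Qed.

Lemma nice_upd F x i : nice F -> bmeas (fun t => F (upd x i t)).
Proof.
move=> nF; apply: (@nice_bmeas F _ _ (fun k t => upd x i t k)) => //.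
by apply: (@upd_measurable _ _ _ (fun k _ => x k)).
Qed.

Lemma nice_integrate i F : nice F -> nice (integrate i F).
Proof.
move=> nF; split; last first.
  have [_ [M FM]] := nF.
  by exists M => x; apply: avg_bound => //; exact: nice_upd.
move=> d T c mc.
have := @nice_bmeas F _ (T * R)%type (fun k z => upd (c ^~ z.1) i z.2 k) nF.
have mc' : forall k, measurable_fun setT
    (fun z : T * R => upd (c ^~ z.1) i z.2 k).
  apply: (@upd_measurable _ _ _ (fun k (z : T * R) => c k z.1)) => // k.
  exact: measurableT_comp.
by move=> /(_ mc') /bmeas_avg [].
Qed.

Lemma nice_integrate_seq l F : nice F -> nice (integrate_seq l F).
Proof. by move=> nF; elim: l => //= i l; exact: nice_integrate. Qed.

Lemma integrateD i F G x : nice F -> nice G ->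
  integrate i (fun x => F x + G x) x = integrate i F x + integrate i G x.
Proof. by move=> nF nG; apply: avgD; exact: nice_upd. Qed.

Lemma integrate_seqD l F G x : nice F -> nice G ->
  integrate_seq l (fun x => F x + G x) x =
  integrate_seq l F x + integrate_seq l G x.
Proof.
move=> nF nG; elim: l x => //= i l IH x.
rewrite -integrateD; [|exact: nice_integrate_seq..].
by congr integrate; apply/funext => y.
Qed.

Lemma integrateZ i r F x : nice F ->
  integrate i (fun x => r * F x) x = r * integrate i F x.
Proof. by move=> nF; apply: avgZ; exact: nice_upd. Qed.

Lemma integrate_seqZ l r F x : nice F ->
  integrate_seq l (fun x => r * F x) x = r * integrate_seq l F x.
Proof.
move=> nF; elim: l x => //= i l IH x.
rewrite -integrateZ; last exact: nice_integrate_seq.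
by congr integrate; apply/funext => y.
Qed.

Lemma integrate_seq_cst l (r : R) x : integrate_seq l (fun=> r) x = r.
Proof.
elim: l x => //= i l IH x; rewrite /integrate.
rewrite -[RHS]avg_cst; congr avg; apply/funext => t; exact: IH.
Qed.

Lemma le_integrate_seq l F G x : nice F -> nice G -> (forall x, F x <= G x) ->
  integrate_seq l F x <= integrate_seq l G x.
Proof.
move=> nF nG FG; elim: l x => //= i l IH x.
by apply: le_avg => [||t]; [exact/nice_upd/nice_integrate_seq..|exact: IH].
Qed.

Lemma updC (x : nat -> R) i j s t : i != j ->
  upd (upd x i s) j t = upd (upd x j t) i s.
Proof.
move=> ij; apply/funext => k; rewrite /upd.
by case: (eqVneq k j) => // ->; rewrite eq_sym (negbTE ij).
Qed.

Lemma integrateC i j F : nice F ->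
  integrate i (integrate j F) = integrate j (integrate i F).
Proof.
move=> nF; have [->//|ij] := eqVneq i j; apply/funext => x.
rewrite /integrate.
rewrite [RHS](_ : _ = avg (fun t => avg (fun s => F (upd (upd x i s) j t)))).
  apply: (avg_swap (F := fun z => F (upd (upd x i z.1) j z.2))).
  apply: (@nice_bmeas F _ _ (fun k (z : R * R) => upd (upd x i z.1) j z.2 k)) => //.
  apply: (@upd_measurable _ _ _ (fun k (z : R * R) => upd x i z.1 k)) => //.
  exact: (@upd_measurable _ _ _ (fun k (z : R * R) => x k)).
by congr avg; apply/funext => t; congr avg; apply/funext => s; rewrite (updC _ _ _ ij).
Qed.

Lemma integrate_seq_cat l1 l2 F :
  integrate_seq (l1 ++ l2) F = integrate_seq l1 (integrate_seq l2 F).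
Proof. exact: foldr_cat. Qed.

(** By Fubini: the first index of one list is located in the other and commuted to its front. *)
Lemma integrate_seq_perm l1 l2 F : nice F -> perm_eq l1 l2 ->
  integrate_seq l1 F = integrate_seq l2 F.
Proof.
move=> nF; elim: l1 l2 => [|i l1 IH] l2.
  by rewrite perm_sym => /perm_nilP ->.
move=> pl; have il2 : i \in l2.
  by rewrite -(perm_mem pl) mem_head.
case/splitPr: il2 pl => s1 s2.
rewrite perm_sym perm_catC /= perm_cons perm_catC => pl.
rewrite /= (IH (s1 ++ s2)) 1?perm_sym //.
elim: s1 {pl} => //= j s1 <-.
by rewrite integrateC //; exact: nice_integrate_seq.
Qed.

Lemma upd_comp (x : nat -> R) i t (s s' : nat -> nat) : cancel s s' ->
  cancel s' s -> upd x i t \o s = upd (x \o s) (s' i) t.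
Proof.
by move=> sK s'K; apply/funext => k; rewrite /upd /= (can2_eq sK s'K).
Qed.

(** Composition with [s] turns an update at [i] into an update at [s' i], so the list of integrated
    coordinates is mapped by the inverse. *)
Lemma integrate_seq_rename l F x (s s' : nat -> nat) : cancel s s' ->
  cancel s' s ->
  integrate_seq l (fun x => F (x \o s)) x =
  integrate_seq [seq s' i | i <- l] F (x \o s).
Proof.
move=> sK s'K; elim: l x => //= i l IH x; congr avg; apply/funext => t.
by rewrite IH (upd_comp _ _ _ sK s'K).
Qed.

End Nice.

(** * Edge products over triangle-trees *)

Section Graphs.
Implicit Types n : nat.

Lemma gnat_ord n (g : rel 'I_n) (i j : 'I_n) : gnat g i j = g i j.
Proof. by rewrite /gnat !valK. Qed.

Lemma gnat_lt n (g : rel 'I_n) i j : gnat g i j -> (i < n)%N && (j < n)%N.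
Proof. by rewrite /gnat; case: insubP => // a -> _; case: insubP => // b ->. Qed.

Lemma gnatC n (g : rel 'I_n) i j : symmetric g -> gnat g i j = gnat g j i.
Proof.
by move=> gs; rewrite /gnat; case: insub => [a|]; case: insub => [b|] //.
Qed.

Lemma gnatxx n (g : rel 'I_n) i : irreflexive g -> gnat g i i = false.
Proof. by move=> gi; rewrite /gnat; case: insub => [a|]. Qed.

Lemma triC a b c x y : tri a b c x y = tri a b c y x.
Proof. by rewrite /tri eq_sym [X in _ && X]andbC. Qed.

Lemma trixx a b c x : tri a b c x x = false.
Proof. by rewrite /tri eqxx. Qed.

Lemma triangle_tree_simple n (g : rel 'I_n) : triangle_tree g ->
  symmetric g /\ irreflexive g.
Proof.
elim=> {n g} [|n g v _ [gs gi]|n g u v _ [gs gi] _|n g s _ [gs gi]].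
- by split=> [i j|i]; rewrite ?eqxx // eq_sym.
- split=> [i j|i]; rewrite /add_tri_vertex; first by rewrite (gnatC _ _ gs) triC.
  by rewrite (gnatxx _ gi) trixx.
- split=> [i j|i]; rewrite /add_tri_edge.
    rewrite (gnatC _ _ gs) triC; reflexivity.
  rewrite (gnatxx _ gi) trixx; reflexivity.
- by split=> [i j|i]; [exact: gs|exact: gi].
Qed.

Section BigEdges.
Variables (T : Type) (idx : T) (op : Monoid.com_law idx).
Implicit Type F : nat -> nat -> T.

(** Edges are grouped by their larger endpoint: new vertices get the largest indices, so gluing
    appends terms at the end. A generic [op] serves both the edge count and the edge product. *)
Lemma big_edges n (g : rel 'I_n) F :
  \big[op/idx]_(p in edges g) F (val p.1) (val p.2) =
  \big[op/idx]_(0 <= j < n) \big[op/idx]_(0 <= i < j | gnat g i j) F i j.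
Proof.
rewrite (eq_bigl (fun p : 'I_n * 'I_n => true && ((p.1 < p.2)%N && g p.1 p.2)));
  last by move=> p; rewrite inE.
rewrite -(pair_big_dep xpredT (fun i j : 'I_n => (i < j)%N && g i j)
  (fun i j => F i j)) /= (exchange_big_dep xpredT) //= big_mkord; apply: eq_bigr => j _.
rewrite (big_nat_widen _ _ _ _ _ (ltnW (ltn_ord j))) big_mkord.
by apply: eq_bigl => i; rewrite gnat_ord andbC.
Qed.

(** A relabelling can reverse the order of an edge's endpoints, so it is studied on ordered pairs,
    where each edge is seen twice. *)
Lemma big_edges_sym n (g : rel 'I_n) F : symmetric g -> irreflexive g ->
  (forall i j, F i j = F j i) ->
  \big[op/idx]_(p : 'I_n * 'I_n | g p.1 p.2) F p.1 p.2 =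
  op (\big[op/idx]_(p in edges g) F (val p.1) (val p.2))
     (\big[op/idx]_(p in edges g) F (val p.1) (val p.2)).
Proof.
move=> gs gi Fs; rewrite (bigID (fun p : 'I_n * 'I_n => (p.1 < p.2)%N)) /=.
congr (op _ _); first by apply: eq_bigl => p; rewrite inE andbC.
rewrite (reindex_inj (h := fun p : 'I_n * 'I_n => (p.2, p.1))) /=; last first.
  by move=> [a b] [c d] [-> ->].
apply: eq_big => [[i j]|[i j] _] /=; last by rewrite Fs.
rewrite inE /= gs -leqNgt leq_eqVlt andbC.
by case: eqP => //= /val_inj ->; rewrite gi ltnn.
Qed.

Lemma big_pred2_nat n u v F k : (u < n)%N -> (v < n)%N -> u != v ->
  \big[op/idx]_(0 <= i < n | (i == u) || (i == v)) F i k = op (F u k) (F v k).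
Proof.
move=> un vn uv; rewrite big_mkord (bigD1 (Ordinal un)) /= ?eqxx //.
rewrite (big_pred1 (Ordinal vn)) // => i; rewrite /= -!val_eqE /=.
by case: (eqVneq (val i) u) => [->|_]; rewrite ?(negbTE uv) ?andbF ?andbT ?orbF.
Qed.

(** The edge [u v] is already in [g], so a triangle glued along it contributes only two factors. *)
Lemma big_edges_add_edge n (g : rel 'I_n) (u v : 'I_n) F :
  symmetric g -> irreflexive g -> g u v ->
  \big[op/idx]_(p in edges (add_tri_edge g u v)) F (val p.1) (val p.2) =
  op (\big[op/idx]_(p in edges g) F (val p.1) (val p.2)) (op (F u n) (F v n)).
Proof.
move=> gs gi guv.
have uv : val u != val v by apply: contraTneq guv => /val_inj ->; rewrite gi.
have E i j : (i <= n)%N -> (j <= n)%N ->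
    gnat (add_tri_edge g u v) i j = gnat g i j || tri u v n i j.
  by move=> ni nj; rewrite (gnat_ord _ (@Ordinal n.+1 i ni) (@Ordinal n.+1 j nj)).
rewrite !big_edges big_nat_recr //=; congr (op _ _).
  apply: eq_big_nat => j /andP[_ jn]; rewrite big_nat_cond [RHS]big_nat_cond.
  apply: eq_bigl => i; case: (ltnP i j) => //= ij.
  rewrite E ?(ltnW jn) ?(ltnW (ltn_trans ij jn)) //.
  case: (boolP (tri _ _ _ _ _)); rewrite ?orbF // orbT.
  case/and3P => _; rewrite !inE (ltn_eqF jn) (ltn_eqF (ltn_trans ij jn)) !orbF.
  case/orP => /eqP Ei /orP[] /eqP Ej; move: ij; rewrite Ei Ej ?ltnn //.
    by rewrite gnat_ord guv.
  by rewrite gnat_ord gs guv.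
rewrite -(big_pred2_nat (n := n) F n (ltn_ord u) (ltn_ord v) uv).
rewrite big_nat_cond [RHS]big_nat_cond; apply: eq_bigl => i.
case: (ltnP i n) => //= ni; rewrite E ?(ltnW ni) //.
have -> : gnat g i n = false.
  by apply/negP => /gnat_lt /andP[_]; rewrite ltnn.
by rewrite /tri !inE (ltn_eqF ni) eqxx !orbT /= orbF andbT.
Qed.

Lemma big_edges_add_vertex n (g : rel 'I_n) (v : 'I_n) F :
  \big[op/idx]_(p in edges (add_tri_vertex g v)) F (val p.1) (val p.2) =
  op (\big[op/idx]_(p in edges g) F (val p.1) (val p.2))
     (op (F v n) (op (F v n.+1) (F n n.+1))).
Proof.
have E i j : (i < n.+2)%N -> (j < n.+2)%N ->
    gnat (add_tri_vertex g v) i j = gnat g i j || tri v n n.+1 i j.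
  by move=> ni nj; rewrite (gnat_ord _ (Ordinal ni) (Ordinal nj)).
have N i j : (n <= j)%N -> gnat g i j = false.
  by move=> nj; apply/negP => /gnat_lt /andP[_]; rewrite ltnNge nj.
have vn := ltn_ord v.
rewrite !big_edges !big_nat_recr //= -Monoid.mulmA; congr (op _ _); [|congr (op _ _)].
- apply: eq_big_nat => j /andP[_ jn]; rewrite big_nat_cond [RHS]big_nat_cond.
  apply: eq_bigl => i; case: (ltnP i j) => //= ij.
  rewrite E; [|lia..]; rewrite orbC /tri !inE.
  suff -> : [&& i != j, [|| i == v, i == n | i == n.+1] &
    [|| j == v, j == n | j == n.+1]] = false by [].
  by lia.
- have -> : F v n = \big[op/idx]_(0 <= i < n | i == v) F i n.
    by rewrite big_mkord (big_pred1 v).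
  rewrite big_nat_cond [RHS]big_nat_cond; apply: eq_bigl => i.
  case: (ltnP i n) => //= ni; rewrite E ?N //; [|lia..].
  by rewrite /tri !inE; lia.
- rewrite -(big_pred2_nat (n := n.+1) F n.+1 (leqW vn) (ltnSn n)); last by lia.
  rewrite big_nat_cond [RHS]big_nat_cond; apply: eq_bigl => i.
  case: (ltnP i n.+1) => //= ni; rewrite E ?N //; [|lia..].
  by rewrite /tri !inE; lia.
Qed.

Lemma big_edges_relabel n (g : rel 'I_n) (s : {perm 'I_n}) F :
  \big[op/idx]_(p : 'I_n * 'I_n | g (s p.1) (s p.2)) F p.1 p.2 =
  \big[op/idx]_(p : 'I_n * 'I_n | g p.1 p.2)
    F ((s^-1)%g p.1) ((s^-1)%g p.2).
Proof.
rewrite [RHS](reindex_inj (h := fun p => (s p.1, s p.2))) /=; last first.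
  by move=> [a b] [c d] [/perm_inj -> /perm_inj ->].
by apply: eq_bigr => p _; rewrite !permK.
Qed.

End BigEdges.

Lemma e_countE n (g : rel 'I_n) : e_count g = \sum_(p in edges g) 1%N.
Proof. by rewrite sum1_card. Qed.

Lemma e_count_add_edge n (g : rel 'I_n) (u v : 'I_n) :
  symmetric g -> irreflexive g -> g u v ->
  e_count (add_tri_edge g u v) = (e_count g + 2)%N.
Proof.
by move=> *; rewrite !e_countE (big_edges_add_edge _ (fun _ _ => 1%N)).
Qed.

Lemma e_count_add_vertex n (g : rel 'I_n) (v : 'I_n) :
  e_count (add_tri_vertex g v) = (e_count g + 3)%N.
Proof.
by rewrite !e_countE (big_edges_add_vertex _ _ _ (fun _ _ => 1%N)).
Qed.

Lemma e_count_relabel n (g : rel 'I_n) (s : {perm 'I_n}) :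
  symmetric g -> irreflexive g ->
  e_count (fun i j => g (s i) (s j)) = e_count g.
Proof.
move=> gs gi.
have := big_edges_relabel addn g s (fun _ _ => 1%N).
rewrite (big_edges_sym _ (g := g) (F := fun _ _ => 1%N)) //.
rewrite (big_edges_sym _ (g := fun i j => g (s i) (s j)) (F := fun _ _ => 1%N)) //.
(* Both counts run over ordered pairs and are doubled; halving gives the claim. *)
rewrite -!e_countE /= !addnn => /double_inj.
exact.
Qed.

Lemma big_edges_base (T : Type) (idx : T) (op : Monoid.com_law idx) F :
  \big[op/idx]_(p in edges (fun i j : 'I_3 => i != j)) F (val p.1) (val p.2) =
  op (F 0 1) (op (F 0 2) (F 1 2)).
Proof.
have E i j : (i < 3)%N -> (j < 3)%N ->
    gnat (fun i j : 'I_3 => i != j) i j = (i != j).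
  by move=> ni nj; rewrite (gnat_ord _ (Ordinal ni) (Ordinal nj)).
rewrite big_edges unlock /= !E //= !Monoid.mulm1.
by rewrite Monoid.mul1m.
Qed.

Lemma e_count_base : e_count (fun i j : 'I_3 => i != j) = 3%N.
Proof. by rewrite e_countE (big_edges_base _ (fun _ _ => 1%N)). Qed.

End Graphs.

(** * Gluing triangle measures *)

(** The integral over the cube [0,1]^n; coordinates from [n] on keep the value 0, the default also
    used by [iint]. *)
Definition mean (R : realType) (n : nat) (F : (nat -> R) -> R) : R :=
  integrate_seq (iota 0 n) F (fun=> 0).

Definition depends_below (R : realType) (n : nat) (F : (nat -> R) -> R) :=
  forall x i t, (n <= i)%N -> F (upd x i t) = F x.

Section Mean.
Variable R : realType.
Implicit Types F G K : (nat -> R) -> R.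

Lemma meanS n F : mean n.+1 F = mean n (integrate n F).
Proof. by rewrite /mean -[n.+1]addn1 iotaD add0n integrate_seq_cat. Qed.

Lemma meanD n F G : nice F -> nice G ->
  mean n (fun x => F x + G x) = mean n F + mean n G.
Proof. exact: integrate_seqD. Qed.

Lemma meanZ n r F : nice F ->
  mean n (fun x => r * F x) = r * mean n F.
Proof. exact: integrate_seqZ. Qed.

Lemma le_mean n F G : nice F -> nice G -> (forall x, F x <= G x) ->
  mean n F <= mean n G.
Proof. exact: le_integrate_seq. Qed.

Lemma integrate_indep i F G x : (forall t, F (upd x i t) = F x) -> nice G ->
  integrate i (fun x => F x * G x) x = F x * integrate i G x.
Proof.
move=> Fi nG; rewrite -avgZ; last exact: nice_upd.
by congr avg; apply/funext => t; rewrite Fi.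
Qed.

(** [F] is constant in coordinate [n] and leaves the inner average, which is 1. Thus drawing a new
    vertex from a conditional density keeps the law of the old ones. *)
Lemma mean_extend n F K : depends_below n F -> nice K ->
  (forall x, integrate n K x = 1) ->
  mean n.+1 (fun x => F x * K x) = mean n F.
Proof.
move=> dF nK K1; rewrite meanS; congr mean; apply/funext => x.
by rewrite integrate_indep ?K1 ?mulr1 // => t; rewrite dF.
Qed.

Lemma upd_same (x : nat -> R) i t : upd x i t i = t.
Proof. by rewrite /upd eqxx. Qed.

Lemma upd_ltn (x : nat -> R) i j t : (j < i)%N -> upd x i t j = x j.
Proof. by rewrite /upd => /ltn_eqF ->. Qed.

Lemma depends_belowM n F G : depends_below n F -> depends_below n G ->
  depends_below n (fun x => F x * G x).
Proof. by move=> dF dG x i t ni; rewrite dF ?dG. Qed.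

Lemma depends_belowD n F G : depends_below n F -> depends_below n G ->
  depends_below n (fun x => F x + G x).
Proof. by move=> dF dG x i t ni; rewrite dF ?dG. Qed.

Lemma depends_below_kernel n (k : R -> R -> R) u v : (u < n)%N -> (v < n)%N ->
  depends_below n (fun x => k (x u) (x v)).
Proof.
by move=> un vn x i t ni; rewrite !upd_ltn //; exact: leq_trans ni.
Qed.

Lemma depends_belowW m n F : (m <= n)%N -> depends_below m F -> depends_below n F.
Proof. by move=> mn dF x i t ni; apply: dF; exact: leq_trans ni. Qed.

End Mean.

(** * Marginals and transitions of the triangle measure *)

Section Marginals.
Variables (R : realType) (W : R -> R -> R) (delta : R).

(** The edge and vertex marginals below belong to the unnormalised measure with density
    [W a b * W a t * W b t], whose total mass is the triangle density. *)
Definition codegree a b := avg (fun t => W a t * W b t).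
Definition edge_density a b := W a b * codegree a b.
Definition vertex_density a := avg (edge_density a).

(** Marginals are expressed by testing against bounded measurable functions, without pushforward
    measures. *)
Definition has_edge_marginal n (nu : (nat -> R) -> R) u v :=
  forall phi, nice_kernel phi ->
    mean n (fun x => nu x * phi (x u) (x v)) =
    avg (fun a => avg (fun b => edge_density a b * phi a b)).

Definition has_vertex_marginal n (nu : (nat -> R) -> R) v :=
  forall f : R -> R, nice (fun x => f (x 0%N)) ->
    mean n (fun x => nu x * f (x v)) =
    avg (fun a => vertex_density a * f a).

Hypothesis W_nice : nice_kernel W.
Hypothesis W_sym : forall a b, W a b = W b a.
Hypothesis delta_gt0 : 0 < delta.
Hypothesis W_ge : forall a b, delta <= W a b.

Let W_ge0 a b : 0 <= W a b.
Proof. by rewrite (le_trans (ltW delta_gt0)). Qed.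

Lemma nice_kernel_coord (k : R -> R -> R) i j : nice_kernel k -> nice (fun x : nat -> R => k (x i) (x j)).
Proof. by move=> nk; apply: nice_kernelP => //; exact: env_measurable_coord. Qed.

Lemma nice_fun_coord (f : R -> R) i : nice (fun x => f (x 0%N)) ->
  nice (fun x => f (x i)).
Proof.
move=> nf; apply: (nice_comp (h := fun _ x => x i) nf) => _.
exact: env_measurable_coord.
Qed.

Lemma nice_codegree : nice_kernel codegree.
Proof.
apply: (nice_integrate 2 (F := fun x => W (x 0%N) (x 2%N) * W (x 1%N) (x 2%N))).
by apply: niceM; exact: nice_kernel_coord.
Qed.

Lemma nice_edge_density : nice_kernel edge_density.
Proof. by apply: niceM; [exact: W_nice|exact: nice_codegree]. Qed.

Lemma nice_vertex_density : nice (fun x => vertex_density (x 0%N)).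
Proof. exact: (nice_integrate 1 nice_edge_density). Qed.

Lemma nice_section (k : R -> R -> R) a : nice_kernel k -> bmeas (R := R) (k a).
Proof. by move=> nk; exact: (nice_upd (fun=> a) 1 nk). Qed.

Lemma nice_fun_bmeas (f : R -> R) : nice (fun x => f (x 0%N)) -> bmeas (R := R) f.
Proof. by move=> nf; exact: (nice_upd (fun=> 0) 0 nf). Qed.

Lemma codegree_ge a b : delta ^+ 2 <= codegree a b.
Proof.
rewrite -(avg_cst (delta ^+ 2)); apply: le_avg; first exact: bmeas_cst.
  apply: (nice_section (k := fun _ t => W a t * W b t) a).
  by apply: niceM; apply: nice_kernelP => //; exact: env_measurable_coord.
by move=> t; rewrite expr2 ler_pM // ltW.
Qed.

Lemma codegree_gt0 a b : 0 < codegree a b.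
Proof. by rewrite (lt_le_trans _ (codegree_ge a b)) // exprn_gt0. Qed.

Lemma codegreeC a b : codegree a b = codegree b a.
Proof. by congr avg; apply/funext => t; rewrite mulrC. Qed.

Lemma edge_densityC a b : edge_density a b = edge_density b a.
Proof. by rewrite /edge_density W_sym codegreeC. Qed.

Lemma edge_density_ge a b : delta ^+ 3 <= edge_density a b.
Proof.
by rewrite exprS ler_pM ?exprn_ge0 ?(ltW delta_gt0) // codegree_ge.
Qed.

Lemma vertex_density_ge a : delta ^+ 3 <= vertex_density a.
Proof.
rewrite -(avg_cst (delta ^+ 3)); apply: le_avg; first exact: bmeas_cst.
  exact: nice_section nice_edge_density.
by move=> t; exact: edge_density_ge.
Qed.

Lemma vertex_density_gt0 a : 0 < vertex_density a.
Proof. by rewrite (lt_le_trans _ (vertex_density_ge a)) // exprn_gt0. Qed.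

Lemma nice_kernel_swap (k : R -> R -> R) : nice_kernel k -> nice_kernel (fun a b => k b a).
Proof. exact: nice_kernel_coord. Qed.

Lemma avg_kernel_swap (k : R -> R -> R) : nice_kernel k ->
  avg (fun a => avg (k a)) = avg (fun b => avg (fun a => k a b)).
Proof. by move=> nk; exact: (congr1 (@^~ (fun=> 0)) (integrateC 0 1 nk)). Qed.

Lemma has_edge_marginal_sym n nu u v :
  has_edge_marginal n nu u v -> has_edge_marginal n nu v u.
Proof.
move=> muv phi nphi; rewrite (muv _ (nice_kernel_swap nphi)) avg_kernel_swap.
  congr avg; apply/funext => a; congr avg; apply/funext => b.
  rewrite edge_densityC; reflexivity.
by apply: niceM; [exact: nice_edge_density|exact: nice_kernel_swap].
Qed.

Lemma edge_vertex_marginal n nu u v :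
  has_edge_marginal n nu u v -> has_vertex_marginal n nu u.
Proof.
move=> muv f nf; rewrite (muv (fun a _ => f a) nf).
congr avg; apply/funext => a; rewrite [RHS]mulrC -avgZ.
  by congr avg; apply/funext => b; rewrite mulrC.
exact: nice_section nice_edge_density.
Qed.

Lemma has_edge_marginal_extend n nu K u v : depends_below n nu ->
  nice K -> (forall x, integrate n K x = 1) -> (u < n)%N -> (v < n)%N ->
  has_edge_marginal n nu u v ->
  has_edge_marginal n.+1 (fun x => nu x * K x) u v.
Proof.
move=> dnu nK K1 un vn muv phi nphi; rewrite -muv //.
rewrite -(mean_extend _ nK K1); last first.
  by apply: depends_belowM => //; exact: depends_below_kernel.
by congr mean; apply/funext => x; rewrite mulrAC.
Qed.

Lemma has_vertex_marginal_extend n nu K v : depends_below n nu ->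
  nice K -> (forall x, integrate n K x = 1) -> (v < n)%N ->
  has_vertex_marginal n nu v ->
  has_vertex_marginal n.+1 (fun x => nu x * K x) v.
Proof.
move=> dnu nK K1 vn mv f nf; rewrite -mv //.
rewrite -(mean_extend _ nK K1); last first.
  apply: depends_belowM => //.
  exact: (depends_below_kernel (fun a _ => f a) vn vn).
by congr mean; apply/funext => x; rewrite mulrAC.
Qed.

(* Conditional densities of a new vertex n: the first one continues the edge
   marginal from v, the second one completes the edge u v to a triangle. *)
Definition edge_transition v n (x : nat -> R) :=
  edge_density (x v) (x n) / vertex_density (x v).

Definition triangle_transition u v n (x : nat -> R) :=
  W (x u) (x n) * W (x v) (x n) / codegree (x u) (x v).

Lemma nice_edge_transition v n : nice (edge_transition v n).
Proof.
apply: niceM; first exact: nice_kernel_coord nice_edge_density.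
apply: (niceV (e := delta ^+ 3)); first exact: exprn_gt0.
  by move=> x; exact: vertex_density_ge.
exact: nice_fun_coord nice_vertex_density.
Qed.

Lemma nice_triangle_transition u v n : nice (triangle_transition u v n).
Proof.
apply: niceM; first by apply: niceM; exact: nice_kernel_coord.
apply: (niceV (e := delta ^+ 2)); first exact: exprn_gt0.
  by move=> x; exact: codegree_ge.
exact: nice_kernel_coord nice_codegree.
Qed.

Lemma edge_transition_integral v n x : (v < n)%N ->
  integrate n (edge_transition v n) x = 1.
Proof.
move=> vn; rewrite -[RHS](@mulVf _ (vertex_density (x v))); last first.
  by rewrite gt_eqF // vertex_density_gt0.
rewrite -avgZ; last exact: nice_section nice_edge_density.
congr avg; apply/funext => t.
by rewrite /edge_transition upd_same upd_ltn // mulrC.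
Qed.

Lemma triangle_transition_integral u v n x : (u < n)%N -> (v < n)%N ->
  integrate n (triangle_transition u v n) x = 1.
Proof.
move=> un vn; rewrite -[RHS](@mulVf _ (codegree (x u) (x v))); last first.
  by rewrite gt_eqF // codegree_gt0.
rewrite -avgZ.
  congr avg; apply/funext => t.
  by rewrite /triangle_transition upd_same !upd_ltn // mulrC.
apply: (nice_section (k := fun _ t => W (x u) t * W (x v) t) 0).
by apply: niceM; apply: nice_kernelP => //; exact: env_measurable_coord.
Qed.

Lemma edge_transition_ge0 v n x : 0 <= edge_transition v n x.
Proof.
rewrite divr_ge0 ?(ltW (vertex_density_gt0 _)) //.
by rewrite mulr_ge0 ?(ltW (codegree_gt0 _ _)).
Qed.

Lemma triangle_transition_ge0 u v n x : 0 <= triangle_transition u v n x.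
Proof. by rewrite divr_ge0 ?(ltW (codegree_gt0 _ _)) ?mulr_ge0. Qed.

Lemma depends_edge_transition v n : (v < n)%N ->
  depends_below n.+1 (edge_transition v n).
Proof.
by move=> vn x i t ni; rewrite /edge_transition !upd_ltn //; lia.
Qed.

Lemma depends_triangle_transition u v n : (u < n)%N -> (v < n)%N ->
  depends_below n.+1 (triangle_transition u v n).
Proof.
by move=> un vn x i t ni; rewrite /triangle_transition !upd_ltn //; lia.
Qed.

(** The vertex marginal at [v] cancels the denominator of the transition. *)
Lemma edge_transition_marginal n nu v : nice nu -> depends_below n nu ->
  (v < n)%N -> has_vertex_marginal n nu v ->
  has_edge_marginal n.+1 (fun x => nu x * edge_transition v n x) v n.
Proof.
move=> nnu dnu vn mv phi nphi.
pose k a t := edge_density a t / vertex_density a * phi a t.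
have nk : nice_kernel k.
  by apply: niceM => //; exact: (nice_edge_transition 0 1).
transitivity (mean n (fun x => nu x * avg (k (x v)))).
  rewrite meanS; congr mean; apply/funext => x.
  transitivity (integrate n (fun x => nu x * k (x v) (x n)) x).
    by congr integrate; apply/funext => y; rewrite -mulrA.
  rewrite integrate_indep; [|by move=> t; rewrite dnu|exact: nice_kernel_coord].
  congr (_ * avg _); apply/funext => t.
  by rewrite upd_same upd_ltn.
rewrite (mv (fun a => avg (k a))); last exact: (nice_integrate 1 nk).
congr avg; apply/funext => a; rewrite -avgZ; last exact: nice_section nk.
congr avg; apply/funext => b; rewrite mulrA; congr (_ * _).
by rewrite mulrC divfK // gt_eqF // vertex_density_gt0.
Qed.

(** Edge marginal times transition is the full triangle density; averaging out the coordinate of [v]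
    leaves the edge marginal on the pair [u n]. *)
Lemma triangle_transition_marginal n nu u v : nice nu -> depends_below n nu ->
  (u < n)%N -> (v < n)%N -> has_edge_marginal n nu u v ->
  has_edge_marginal n.+1 (fun x => nu x * triangle_transition u v n x) u n.
Proof.
move=> nnu dnu un vn muv phi nphi.
pose K (x : nat -> R) := triangle_transition 0 1 2 x * phi (x 0%N) (x 2%N).
have nK : nice K.
  apply: niceM; first exact: nice_triangle_transition.
  exact: nice_kernel_coord.
pose k a b := avg (fun t => W a t * W b t / codegree a b * phi a t).
have nk : nice_kernel k by exact: (nice_integrate 2 nK).
transitivity (mean n (fun x => nu x * k (x u) (x v))).
  rewrite meanS; congr mean; apply/funext => x.
  transitivity (integrate n (fun x => nu x *
      (triangle_transition u v n x * phi (x u) (x n))) x).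
    by congr integrate; apply/funext => y; rewrite -mulrA.
  rewrite integrate_indep; [|by move=> t; rewrite dnu|].
    congr (_ * avg _); apply/funext => t.
    by rewrite /triangle_transition upd_same !upd_ltn.
  apply: niceM; first exact: nice_triangle_transition.
  exact: nice_kernel_coord.
rewrite (muv k nk); congr avg; apply/funext => a.
(* The triangle density times the test function: the codegree in the edge marginal has cancelled the
   one in the transition. *)
pose h b t := W a b * W a t * W b t * phi a t.
have nh : nice_kernel h.
  by apply: niceM; first apply: niceM; first apply: niceM;
    apply: nice_kernelP => //; exact: env_measurable_coord.
transitivity (avg (fun b => avg (h b))).
  congr avg; apply/funext => b; rewrite -avgZ.
    congr avg; apply/funext => t; rewrite /h /edge_density.
    by field; rewrite gt_eqF // codegree_gt0.
  apply: (nice_section (k := fun _ t => W a t * W b t / codegree a b * phi a t) 0).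
  apply: niceM; last by apply: nice_kernelP => //; exact: env_measurable_coord.
  apply: niceM; last exact: nice_cst.
  by apply: niceM; apply: nice_kernelP => //; exact: env_measurable_coord.
(* With [b] now innermost, averaging over it produces the codegree of [a] and [t]. *)
rewrite avg_kernel_swap //; congr avg; apply/funext => t.
rewrite /edge_density /codegree [RHS]mulrAC -avgZ.
  congr avg; apply/funext => b; rewrite /h (W_sym t b); ring.
apply: (nice_section (k := fun _ b => W a b * W t b) 0).
by apply: niceM; apply: nice_kernelP => //; exact: env_measurable_coord.
Qed.

Lemma triangle_transitionC u v n :
  triangle_transition u v n = triangle_transition v u n.
Proof.
by apply/funext => x; rewrite /triangle_transition codegreeC [W _ _ * _]mulrC.
Qed.

(** * The glued measure and its behaviour under each gluing *)

Definition edge_product n (g : rel 'I_n) (x : nat -> R) : R :=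
  \prod_(p in edges g) W (x (val p.1)) (x (val p.2)).

(** The bound [1 + x <= expR x] at [x = a^-1 - 1], with both sides inverted. *)
Lemma expR_subV_le (a : R) : 0 < a -> expR (1 - a^-1) <= a.
Proof.
move=> a0; rewrite -opprB expRN -[leRHS]invrK lef_pV2 ?posrE ?expR_gt0 ?invr_gt0 //.
by rewrite (le_trans _ (expR_ge1Dx _)) // addrC subrK.
Qed.

Lemma tri_ind (P : nat -> nat -> Prop) a b c x y :
  (forall i j, P i j -> P j i) -> P a b -> P a c -> P b c ->
  tri a b c x y -> P x y.
Proof.
move=> Ps ab ac bc /and3P[xy]; rewrite !inE.
by case/or3P => /eqP Ex /or3P[] /eqP Ey; move: xy; rewrite Ex Ey ?eqxx // => _;
  first [done|exact: Ps].
Qed.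

Lemma gnatP n (g : rel 'I_n) i j : gnat g i j ->
  exists a b : 'I_n, [/\ i = a, j = b & g a b].
Proof.
rewrite /gnat; case: insubP => // a _ <-; case: insubP => // b _ <- gab.
by exists a, b.
Qed.

(* [nu] is the glued measure, [A] the product of the factors alpha and [S] the sum
   of their inverses, for [k] gluings of which [e] are along an edge. *)
Record glued_measure n (g : rel 'I_n) (k e : nat)
    (nu A S : (nat -> R) -> R) : Prop := GluedMeasure {
  glued_nice : nice nu;
  glued_below : depends_below n nu;
  glued_ge0 : forall x, 0 <= nu x;
  glued_niceS : nice S;
  glued_belowS : depends_below n S;
  glued_product : forall x, edge_product g x * 8 ^+ k = nu x * A x * 2 ^+ e;
  glued_exp : forall x, expR (k%:R - S x) <= A x;
  glued_mean : mean n (fun x => nu x * S x) =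
    (k%:R - e%:R) / 8 + e%:R / 4 * avg (fun a => avg (W a));
  glued_edge : forall u v, g u v -> has_edge_marginal n nu u v;
  glued_vertex : forall v : 'I_n, has_vertex_marginal n nu v }.

Lemma exp_step (k : nat) (s A a : R) : 0 < a -> expR (k%:R - s) <= A ->
  expR (k.+1%:R - (s + a^-1)) <= A * a.
Proof.
move=> a0 sA; rewrite (_ : _ - _ = (k%:R - s) + (1 - a^-1)); last first.
  by rewrite -natr1; ring.
by rewrite expRD ler_pM ?expR_ge0 // expR_subV_le.
Qed.

(** A triangle glued at [v] is drawn in two moves: [n] follows the edge marginal given [v], then
    [n.+1] completes the pair. Symmetry of the second transition in [v] and [n] gives the third
    edge. *)
Lemma vertex_transition_marginals n nu v : nice nu -> depends_below n nu ->
  (v < n)%N -> has_vertex_marginal n nu v ->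
  let nu2 x := nu x * edge_transition v n x * triangle_transition v n n.+1 x in
  [/\ has_edge_marginal n.+2 nu2 v n, has_edge_marginal n.+2 nu2 v n.+1 &
      has_edge_marginal n.+2 nu2 n n.+1].
Proof.
move=> nnu dnu vn mv nu2.
pose nu1 x := nu x * edge_transition v n x.
have nnu1 : nice nu1 by apply: niceM => //; exact: nice_edge_transition.
have dnu1 : depends_below n.+1 nu1.
  apply: depends_belowM; last exact: depends_edge_transition.
  exact: depends_belowW dnu.
have m1 : has_edge_marginal n.+1 nu1 v n by exact: edge_transition_marginal.
have vn1 : (v < n.+1)%N by exact: leqW.
split.
- apply: has_edge_marginal_extend => //; first exact: nice_triangle_transition.
  by move=> x; exact: triangle_transition_integral.
- exact: triangle_transition_marginal.
- rewrite /nu2 triangle_transitionC.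
  by apply: triangle_transition_marginal => //; exact: has_edge_marginal_sym.
Qed.

(** The two transitions multiply to the three new edge weights divided by the vertex marginal at
    [v]; hence the factor [8 * vertex_density], whose 8 is the one gained by [8 ^+ k.+1]. *)
Lemma glued_add_vertex n (g : rel 'I_n) (v : 'I_n) k e nu A S :
  glued_measure g k e nu A S ->
  glued_measure (add_tri_vertex g v) k.+1 e
    (fun x => nu x * edge_transition v n x * triangle_transition v n n.+1 x)
    (fun x => A x * (8 * vertex_density (x v)))
    (fun x => S x + (8 * vertex_density (x v))^-1).
Proof.
move=> [nnu dnu nu0 nS dS prodE expA expS eM vM].
have vn : (v < n)%N by [].
have vn1 : (v < n.+1)%N by exact: leqW.
have [m1 m2 m3] := vertex_transition_marginals nnu dnu vn (vM v).
have K1n := nice_edge_transition v n.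
have K2n := nice_triangle_transition v n n.+1.
have K1i x := edge_transition_integral x vn.
have K2i x := triangle_transition_integral x vn1 (ltnSn n).
have dnu1 : depends_below n.+1 (fun x => nu x * edge_transition v n x).
  apply: depends_belowM; last exact: depends_edge_transition.
  exact: depends_belowW dnu.
have d1n i : nice (fun x : nat -> R => (8 * vertex_density (x i))^-1).
  apply: (niceV (e := 8 * delta ^+ 3)).
  - by rewrite mulr_gt0 ?exprn_gt0.
  - by move=> x; rewrite ler_pM2l // vertex_density_ge.
  - apply: niceM; first exact: nice_cst.
    exact: nice_fun_coord nice_vertex_density.
have d1b : depends_below n (fun x : nat -> R => (8 * vertex_density (x v))^-1).
  exact: (depends_below_kernel (fun a _ => (8 * vertex_density a)^-1) vn vn).
split.
- by apply: niceM => //; exact: niceM.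
- apply: depends_belowM; last exact: depends_triangle_transition.
  exact: depends_belowW dnu1.
- move=> x; apply: mulr_ge0; last exact: triangle_transition_ge0.
  by apply: mulr_ge0; [exact: nu0|exact: edge_transition_ge0].
- by apply: niceD => //; exact: d1n.
- apply: (@depends_belowW _ n); first by lia.
  exact: depends_belowD.
- move=> x; rewrite /edge_product.
  rewrite (big_edges_add_vertex _ _ _ (fun i j => W (x i) (x j))) /= -/(edge_product g x).
  rewrite exprSr mulrACA prodE /edge_transition /triangle_transition /edge_density.
  field; rewrite ?gt_eqF ?vertex_density_gt0 ?codegree_gt0 //.
- move=> x; apply: exp_step => //.
  by rewrite mulr_gt0 ?vertex_density_gt0.
(* The updated [S] depends on old coordinates only, so both transitions integrate out. *)
- transitivity (mean n (fun x => nu x * (S x + (8 * vertex_density (x v))^-1))).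
    rewrite -(mean_extend (n := n) _ K1n K1i); last first.
      by apply: depends_belowM; [exact: dnu|exact: depends_belowD].
    rewrite -(mean_extend (n := n.+1) _ K2n K2i); last first.
      apply: depends_belowM; last exact: depends_edge_transition.
      apply: (@depends_belowW _ n); first by lia.
      by apply: depends_belowM; [exact: dnu|exact: depends_belowD].
    by congr mean; apply/funext => x; ring.
  transitivity (mean n (fun x => nu x * S x + nu x * (8 * vertex_density (x v))^-1)).
    by congr mean; apply/funext => x; rewrite mulrDr.
  rewrite meanD; [|exact: niceM|apply: niceM => //; exact: d1n].
  rewrite expS (vM v (fun a => (8 * vertex_density a)^-1)); last first.
    exact: (d1n 0%N).
  (* Against the vertex marginal the inverse factor becomes constant: a vertex gluing adds 1/8. *)
  rewrite (_ : (fun a => vertex_density a * (8 * vertex_density a)^-1) = fun=> 1 / 8); last first.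
    by apply/funext => a; field; rewrite gt_eqF ?vertex_density_gt0.
  by rewrite avg_cst -natr1; field.
(* Old edges keep their marginal through both extensions; new ones are the three pairs of the glued
   triangle. *)
- move=> i j /orP[/gnatP[a [b [-> -> gab]]]|].
    apply: has_edge_marginal_extend => //; [exact: leqW..|].
    by apply: has_edge_marginal_extend => //; exact: eM.
  apply: tri_ind; [|exact: m1|exact: m2|exact: m3].
  by move=> *; exact: has_edge_marginal_sym.
- move=> i; have [ni|] := ltnP i n.
    apply: has_vertex_marginal_extend => //; first exact: leqW.
    by apply: has_vertex_marginal_extend => //; exact: (vM (Ordinal ni)).
  rewrite leq_eqVlt => /predU1P[<-|ni]; first exact: edge_vertex_marginal m3.
  have -> : (i : nat) = n.+1 by have := ltn_ord i; lia.
  exact: edge_vertex_marginal (has_edge_marginal_sym m3).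
Qed.

(** The transition is the product of the two new edge weights divided by the codegree; the extra 8
    splits into the 4 of the new factor and the 2 counted by [e.+1]. *)
Lemma glued_add_edge n (g : rel 'I_n) (u v : 'I_n) k e nu A S :
  symmetric g -> irreflexive g -> g u v ->
  glued_measure g k e nu A S ->
  glued_measure (add_tri_edge g u v) k.+1 e.+1
    (fun x => nu x * triangle_transition u v n x)
    (fun x => A x * (4 * codegree (x u) (x v)))
    (fun x => S x + (4 * codegree (x u) (x v))^-1).
Proof.
move=> gs gi guv [nnu dnu nu0 nS dS prodE expA expS eM vM].
have un : (u < n)%N by [].
have vn : (v < n)%N by [].
have Kn := nice_triangle_transition u v n.
have Ki x := triangle_transition_integral x un vn.
have cn i j : nice (fun x : nat -> R => (4 * codegree (x i) (x j))^-1).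
  apply: (niceV (e := 4 * delta ^+ 2)).
  - by rewrite mulr_gt0 ?exprn_gt0.
  - by move=> x; rewrite ler_pM2l // codegree_ge.
  - apply: niceM; first exact: nice_cst.
    exact: nice_kernel_coord nice_codegree.
have cb : depends_below n (fun x : nat -> R => (4 * codegree (x u) (x v))^-1).
  exact: (depends_below_kernel (fun a b => (4 * codegree a b)^-1) un vn).
have m1 : has_edge_marginal n.+1 (fun x => nu x * triangle_transition u v n x) u n.
  by apply: triangle_transition_marginal => //; exact: eM.
have m2 : has_edge_marginal n.+1 (fun x => nu x * triangle_transition u v n x) v n.
  rewrite triangle_transitionC; apply: triangle_transition_marginal => //.
  by apply: has_edge_marginal_sym; exact: eM.
have old i j : (i < n)%N -> (j < n)%N -> has_edge_marginal n nu i j ->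
    has_edge_marginal n.+1 (fun x => nu x * triangle_transition u v n x) i j.
  by move=> ni nj; exact: has_edge_marginal_extend.
split.
- exact: niceM.
- apply: depends_belowM; last exact: depends_triangle_transition.
  exact: depends_belowW dnu.
- by move=> x; rewrite mulr_ge0 ?triangle_transition_ge0.
- by apply: niceD => //; exact: cn.
- apply: (@depends_belowW _ n); first by lia.
  exact: depends_belowD.
- move=> x; rewrite /edge_product.
  rewrite (big_edges_add_edge _ (fun i j => W (x i) (x j))) //= -/(edge_product g x).
  rewrite exprSr mulrACA prodE /triangle_transition exprSr.
  field; rewrite gt_eqF ?codegree_gt0 //.
- move=> x; apply: exp_step => //.
  by rewrite mulr_gt0 ?codegree_gt0.
- transitivity (mean n (fun x => nu x * (S x + (4 * codegree (x u) (x v))^-1))).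
    rewrite -(mean_extend (n := n) _ Kn Ki); last first.
      by apply: depends_belowM; [exact: dnu|exact: depends_belowD].
    by congr mean; apply/funext => x; ring.
  transitivity (mean n (fun x => nu x * S x + nu x * (4 * codegree (x u) (x v))^-1)).
    by congr mean; apply/funext => x; rewrite mulrDr.
  rewrite meanD; [|exact: niceM|apply: niceM => //; exact: cn].
  rewrite expS (eM _ _ guv (fun a b => (4 * codegree a b)^-1)); last exact: (cn 0%N 1%N).
  (* Against the edge marginal the inverse factor leaves [W / 4]: an edge gluing adds a quarter of
     the edge density. *)
  rewrite (_ : (fun a => avg (fun b => edge_density a b * (4 * codegree a b)^-1)) =
      fun a => 1 / 4 * avg (W a)); last first.
    apply/funext => a; rewrite -avgZ; last exact: nice_section.
    congr avg; apply/funext => b; rewrite /edge_density.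
    by field; rewrite gt_eqF ?codegree_gt0.
  rewrite avgZ; last exact: nice_fun_bmeas (nice_integrate 1 W_nice).
  by rewrite -!natr1; field.
- move=> i j /orP[/gnatP[a [b [-> -> gab]]]|]; first by apply: old => //; exact: eM.
  apply: tri_ind; [|by apply: old => //; exact: eM|exact: m1|exact: m2].
  by move=> *; exact: has_edge_marginal_sym.
- move=> i; have [ni|ni] := ltnP i n.
    by apply: has_vertex_marginal_extend => //; exact: (vM (Ordinal ni)).
  have -> : (i : nat) = n by have := ltn_ord i; lia.
  exact: edge_vertex_marginal (has_edge_marginal_sym m1).
Qed.

Lemma glued_base : glued_measure (fun i j : 'I_3 => i != j) 0 0
  (edge_product (fun i j : 'I_3 => i != j)) (fun=> 1) (fun=> 0).
Proof.
(* The first triangle is treated as glued onto a single vertex distributed by the vertex marginal,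
   which cancels the denominator of the first transition. *)
pose nu (x : nat -> R) := vertex_density (x 0%N).
have nnu : nice nu by exact: nice_vertex_density.
have dnu : depends_below 1 nu.
  exact: (depends_below_kernel (fun a _ => vertex_density a) (ltn0Sn 0) (ltn0Sn 0)).
have mnu : has_vertex_marginal 1 nu 0 by move=> f nf.
have [] := vertex_transition_marginals nnu dnu (ltn0Sn 0) mnu.
have pE x : edge_product (fun i j : 'I_3 => i != j) x =
    W (x 0%N) (x 1%N) * (W (x 0%N) (x 2%N) * W (x 1%N) (x 2%N)).
  by rewrite /edge_product (big_edges_base _ (fun i j => W (x i) (x j))).
set nu2 := (nu2 in has_edge_marginal _ nu2).
have -> : nu2 = edge_product (fun i j : 'I_3 => i != j).
  apply/funext => x; rewrite pE /nu2 /nu.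
  rewrite /edge_transition /triangle_transition /edge_density.
  by field; rewrite ?gt_eqF ?vertex_density_gt0 ?codegree_gt0.
move=> m1 m2 m3; split.
- rewrite (funext pE).
  by do 2 (apply: niceM; first exact: nice_kernel_coord); exact: nice_kernel_coord.
- by move=> x i t i3; rewrite !pE !upd_ltn //; lia.
- by move=> x; rewrite pE !mulr_ge0.
- exact: nice_cst.
- by [].
- by move=> x; rewrite !expr0 !mulr1.
- by move=> x; rewrite subr0 expR0.
- rewrite (_ : (fun x => _) = fun=> 0); last by apply/funext => x; rewrite mulr0.
  rewrite [LHS]integrate_seq_cst; ring.
- move=> u v uv; apply: (tri_ind (P := has_edge_marginal 3 _) _ m1 m2 m3).
    by move=> *; exact: has_edge_marginal_sym.
  rewrite /tri val_eqE uv !inE /=.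
  by have := ltn_ord u; have := ltn_ord v; lia.
- case=> [[|[|[|//]]] i3].
  + exact: edge_vertex_marginal m1.
  + exact: edge_vertex_marginal m3.
  + exact: edge_vertex_marginal (has_edge_marginal_sym m3).
Qed.

End Marginals.

(** * Invariance under relabelling of vertices *)

(** Extending by the identity from [n] on makes the permutation act on whole sequences by
    composition. *)
Definition perm_nat n (s : {perm 'I_n}) (k : nat) : nat :=
  if @insub nat (fun k => (k < n)%N) 'I_n k is Some i then s i else k.

Section Relabel.
Variables (R : realType) (n : nat).
Implicit Type s : {perm 'I_n}.

Lemma perm_nat_ord s (i : 'I_n) : perm_nat s i = s i.
Proof. by rewrite /perm_nat valK. Qed.

Lemma perm_nat_ge s k : (n <= k)%N -> perm_nat s k = k.
Proof. by rewrite /perm_nat; case: insubP => // i kn; rewrite leqNgt kn. Qed.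

Lemma perm_natK s : cancel (perm_nat s) (perm_nat (s^-1)%g).
Proof.
move=> k; have [kn|nk] := ltnP k n; last by rewrite !perm_nat_ge.
by rewrite (perm_nat_ord s (Ordinal kn)) perm_nat_ord permK.
Qed.

Lemma perm_natVK s : cancel (perm_nat (s^-1)%g) (perm_nat s).
Proof. by move=> k; rewrite -{2}(perm_natK (s^-1)%g k) invgK. Qed.

Lemma mean_relabel s (F : (nat -> R) -> R) : nice F ->
  mean n (fun x => F (x \o perm_nat s)) = mean n F.
Proof.
move=> nF; rewrite /mean.
rewrite (integrate_seq_rename _ _ _ (perm_natK s) (perm_natVK s)).
rewrite (@integrate_seq_perm _ _ (iota 0 n)) //.
have inj := can_inj (perm_natVK s).
apply: uniq_perm; rewrite ?map_inj_uniq ?iota_uniq // => k.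
rewrite mem_iota add0n /=; apply/mapP/idP => [[i]|kn].
  rewrite mem_iota add0n /= => ni ->.
  by rewrite (perm_nat_ord _ (Ordinal ni)).
exists (perm_nat s k); last by rewrite perm_natK.
by rewrite mem_iota add0n /= (perm_nat_ord s (Ordinal kn)).
Qed.

Lemma depends_below_relabel s (F : (nat -> R) -> R) : depends_below n F ->
  depends_below n (fun x => F (x \o perm_nat s)).
Proof.
move=> dF x i t ni; rewrite (upd_comp _ _ _ (perm_natK s) (perm_natVK s)).
by rewrite dF // perm_nat_ge.
Qed.

Lemma nice_relabel s (F : (nat -> R) -> R) : nice F ->
  nice (fun x => F (x \o perm_nat s)).
Proof.
move=> nF; apply: (nice_comp (h := fun k x => x (perm_nat s k)) nF) => k.
exact: env_measurable_coord.
Qed.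

Variable W : R -> R -> R.
Hypothesis W_sym : forall a b, W a b = W b a.
Hypothesis W_ge0 : forall a b, 0 <= W a b.

Lemma edge_product_relabel (g : rel 'I_n) s x :
  symmetric g -> irreflexive g ->
  edge_product W (fun i j => g (s i) (s j)) x =
  edge_product W g (x \o perm_nat (s^-1)%g).
Proof.
move=> gs gi; pose P h y : R := @edge_product R W n h y.
have P_ge0 h y : 0 <= P h y by apply: prodr_ge0.
(* Since edges may change orientation, the squares are compared, as products over ordered pairs;
   nonnegativity permits taking roots. *)
apply/eqP; rewrite -(@eqrXn2 _ 2) //; [|exact: P_ge0..]; apply/eqP.
rewrite !expr2 /edge_product.
pose y := x \o perm_nat (s^-1)%g.
rewrite -(big_edges_sym _ (F := fun i j => W (y i) (y j))) //.
rewrite -(big_edges_sym _ (F := fun i j => W (x i) (x j))) //.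
rewrite (big_edges_relabel _ _ _ (fun i j => W (x i) (x j))).
by apply: eq_bigr => p _; rewrite /y /= !perm_nat_ord.
Qed.

Lemma glued_relabel (g : rel 'I_n) s k e nu A S :
  symmetric g -> irreflexive g -> glued_measure W g k e nu A S ->
  let r x := x \o perm_nat (s^-1)%g in
  glued_measure W (fun i j => g (s i) (s j)) k e (nu \o r) (A \o r) (S \o r).
Proof.
move=> gs gi [nnu dnu nu0 nS dS prodE expA expS eM vM] r.
(* Vertex [v] of the relabelled graph plays the role of [s v] in [g], whence the inverse permutation
   in [r]. *)
have sE (x : nat -> R) (v : 'I_n) : x v = r x (s v).
  by rewrite /r /= perm_nat_ord permK.
split.
- exact: nice_relabel.
- exact: depends_below_relabel.
- by move=> x; exact: nu0.
- exact: nice_relabel.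
- exact: depends_below_relabel.
- by move=> x; rewrite edge_product_relabel // prodE.
- by move=> x; exact: expA.
- by rewrite -expS -(mean_relabel (s^-1)%g (niceM nnu nS)).
- move=> u v guv phi nphi; rewrite -(eM _ _ guv phi nphi).
  rewrite -(mean_relabel (s^-1)%g (F := fun y => nu y * phi (y (s u)) (y (s v))));
    last by apply: niceM => //; exact: nice_kernel_coord.
  by congr mean; apply/funext => x /=; rewrite !(sE x).
- move=> v f nf; rewrite -(vM (s v) f nf).
  rewrite -(mean_relabel (s^-1)%g (F := fun y => nu y * f (y (s v))));
    last by apply: niceM => //; exact: nice_fun_coord.
  by congr mean; apply/funext => x /=; rewrite !(sE x).
Qed.

End Relabel.

(** * Glued measures for all triangle-trees and the resulting lower bound *)

Definition positive_kernel (R : realType) (W : R -> R -> R) (delta : R) :=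
  [/\ nice_kernel W, forall a b, W a b = W b a, 0 < delta &
      forall a b, delta <= W a b].

Lemma triangle_tree_gt0 n (g : rel 'I_n) : triangle_tree g -> (0 < n)%N.
Proof. by elim. Qed.

(** [k] and [e] are chosen before [W], because [W] and [1 - W] must share them. Each of the [k.+1]
    triangles brings three edges and each edge gluing merges one pair of them, whence the edge
    count. *)
Lemma glued_measure_exists (R : realType) n (g : rel 'I_n) : triangle_tree g ->
  exists k e, [/\ (e <= k)%N, (e_count g + e = 3 * k.+1)%N &
    forall (W : R -> R -> R) delta, positive_kernel W delta ->
      exists nu A S, glued_measure W g k e nu A S].
Proof.
elim=> {n g} [|n g v tg [k [e [ek cnt ex]]]|n g u v tg [k [e [ek cnt ex]]] guv|
  n g s tg [k [e [ek cnt ex]]]].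
- exists 0%N, 0%N; split=> //; first by rewrite e_count_base.
  move=> W delta [nW Ws d0 dW].
  by do 3 eexists; exact: (glued_base nW Ws d0 dW).
- exists k.+1, e; split; first exact: leqW.
    by rewrite e_count_add_vertex; lia.
  move=> W delta pW; have [nu [A [S gm]]] := ex W delta pW.
  have [nW Ws d0 dW] := pW.
  by do 3 eexists; exact: (glued_add_vertex nW Ws d0 dW v gm).
- have [gs gi] := triangle_tree_simple tg.
  exists k.+1, e.+1; split=> //; first by rewrite e_count_add_edge //; lia.
  move=> W delta pW; have [nu [A [S gm]]] := ex W delta pW.
  have [nW Ws d0 dW] := pW.
  by do 3 eexists; exact: (glued_add_edge nW Ws d0 dW gs gi guv gm).
- have [gs gi] := triangle_tree_simple tg.
  exists k, e; split=> //; first by rewrite e_count_relabel.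
  move=> W delta pW; have [nu [A [S gm]]] := ex W delta pW.
  have [nW Ws d0 dW] := pW.
  have W0 a b : 0 <= W a b by rewrite (le_trans (ltW d0)).
  by do 3 eexists; exact: (glued_relabel Ws W0 s gs gi gm).
Qed.

Lemma nice_edge_product (R : realType) (W : R -> R -> R) n (g : rel 'I_n) :
  nice_kernel W -> nice (edge_product W g).
Proof. by move=> nW; apply: nice_prod => p; exact: nice_kernel_coord. Qed.

(** Pointwise [A >= expR (k - S) >= 1 + (k - S)]; this is integrated against [nu], whose mass and
    whose mean of [S] are known. *)
Lemma glued_lower_bound (R : realType) (W : R -> R -> R) n (g : rel 'I_n)
    k e nu A S : nice_kernel W -> (0 < n)%N -> glued_measure W g k e nu A S ->
  2 ^+ e * (k.+1%:R * avg (vertex_density W) - (k%:R - e%:R) / 8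
            - e%:R / 4 * avg (fun a => avg (W a))) <=
  8 ^+ k * mean n (edge_product W g).
Proof.
move=> nW n0 [nnu dnu nu0 nS dS prodE expA expS eM vM].
(* The mass is the vertex marginal at vertex 0 tested on the constant 1. *)
have nuE : mean n nu = avg (vertex_density W).
  have := vM (Ordinal n0) (fun=> 1) (nice_cst 1).
  rewrite (_ : (fun x => nu x * 1) = nu); last by apply/funext => x; rewrite mulr1.
  by move=> ->; congr avg; apply/funext => a; rewrite mulr1.
have nnS : nice (fun x => nu x * S x) by exact: niceM.
have nP := nice_edge_product g nW.
have nk1 : nice (fun x => k.+1%:R * nu x) by apply: niceM => //; exact: nice_cst.
have nS1 : nice (fun x => -1 * (nu x * S x)) by apply: niceM => //; exact: nice_cst.
rewrite -meanZ //.
rewrite [leLHS](_ : _ =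
    mean n (fun x => 2 ^+ e * (k.+1%:R * nu x + -1 * (nu x * S x)))); last first.
  rewrite meanZ; last exact: niceD.
  by rewrite meanD // !meanZ // nuE expS; ring.
apply: le_mean => [||x].
- apply: niceM; first exact: nice_cst.
  exact: niceD.
- by apply: niceM => //; exact: nice_cst.
rewrite [leRHS]mulrC prodE [leRHS]mulrC ler_pM2l ?exprn_gt0 //.
rewrite [leLHS](_ : _ = nu x * (1 + (k%:R - S x))); last first.
  by rewrite -natr1; ring.
by rewrite ler_wpM2l // (le_trans _ (expA x)) // expR_ge1Dx.
Qed.

(** * Goodman's inequality and the conclusion *)

Section Goodman.
Variables (R : realType) (W : R -> R -> R).
Hypothesis W_nice : nice_kernel W.
Hypothesis W_sym : forall a b, W a b = W b a.

Let U a b := W a b - 1 / 2.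
Let h a := avg (U a).

Let U_nice : nice_kernel U.
Proof. by apply: niceB => //; exact: nice_cst. Qed.

Let h_nice : nice (fun x => h (x 0%N)).
Proof. exact: (nice_integrate 1 U_nice). Qed.

Let Uh_nice : nice_kernel (fun a b => U a b * h b).
Proof. by apply: niceM => //; exact: (nice_fun_coord (f := h) 1). Qed.

(** Both sides are the density of the two-edge path in [U]; the right-hand form is visibly
    nonnegative. *)
Let cherry : avg (fun a => avg (fun b => U a b * h b)) = avg (fun a => h a * h a).
Proof.
rewrite avg_kernel_swap //; congr avg; apply/funext => b.
rewrite -avgZ; last exact: nice_section U_nice.
by congr avg; apply/funext => a; rewrite /U W_sym mulrC.
Qed.

Let cherry_ge0 : 0 <= avg (fun a => h a * h a).
Proof.
rewrite -(avg_cst (0 : R)); apply: le_avg; first exact: bmeas_cst.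
  by apply: (nice_fun_bmeas (f := fun a => h a * h a)); exact: niceM.
by move=> a; rewrite -expr2 sqr_ge0.
Qed.

Let c a b := avg (fun t => U a t * U b t).

Let c_nice : nice_kernel c.
Proof.
apply: (nice_integrate 2
  (F := fun x => U (x 0%N) (x 2%N) * U (x 1%N) (x 2%N))).
by apply: niceM; exact: nice_kernel_coord.
Qed.

(** The sign [s] is 1 for [W] and -1 for [1 - W], so one expansion serves both. *)
Let codegree_expand s V : (forall a b, V a b = 1 / 2 + s * U a b) ->
  forall a b, codegree V a b = 1 / 4 + s / 2 * (h a + h b) + s ^+ 2 * c a b.
Proof.
move=> VE a b.
have bU x := nice_section x U_nice.
have bD := bmeasD (bU a) (bU b).
have bM := bmeasM (bU a) (bU b).
have bZ r f : bmeas (R := R) f -> bmeas (fun t => r * f t).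
  by move=> bf; exact: bmeasM (bmeas_cst _ r) bf.
rewrite -(avgD (bU a) (bU b)) -(avgZ _ bD) -(avgZ _ bM) -[1 / 4]avg_cst.
rewrite -(avgD (bmeas_cst _ _) (bZ _ _ _ _ bD)).
rewrite -(avgD (bmeasD (bmeas_cst _ _) (bZ _ _ _ _ bD)) (bZ _ _ _ _ bM)).
by congr avg; apply/funext => t; rewrite !VE; field.
Qed.

(* With U = W - 1/2, the cubic terms of W W W + (1 - W) (1 - W) (1 - W) cancel. *)
Lemma goodman :
  1 / 4 <= avg (vertex_density W) + avg (vertex_density (fun a b => 1 - W a b)).
Proof.
set W' := fun a b => 1 - W a b.
have nW' : nice_kernel W' by apply: niceB => //; exact: nice_cst.
(* Each of the three terms beside 1/4 averages to the two-edge path density of [U], so the total is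
   1/4 plus three times a nonnegative number. *)
have edgeE a b : edge_density W a b + edge_density W' a b =
    (1 / 4 + U b a * h a) + (U a b * h b + c a b).
  rewrite /edge_density (codegree_expand (s := 1)); last first.
    by move=> x y; rewrite /U; field.
  rewrite (codegree_expand (s := -1)); last first.
    by move=> x y; rewrite /W' /U; field.
  by rewrite /W' /U (W_sym b a); field.
have n1 : nice_kernel (fun a b => U b a * h a) by exact: nice_kernel_swap Uh_nice.
have n2 := nice_edge_density W_nice.
have n3 := nice_edge_density nW'.
have avg2D (k l : R -> R -> R) : nice_kernel k -> nice_kernel l ->
    avg (fun a => avg (fun b => k a b + l a b)) =
    avg (fun a => avg (k a)) + avg (fun a => avg (l a)).
  move=> nk nl.
  have bavg m : nice_kernel m -> bmeas (R := R) (fun a => avg (m a)).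
    by move=> nm; exact: nice_fun_bmeas (nice_integrate 1 nm).
  rewrite -(avgD (bavg _ nk) (bavg _ nl)).
  by congr avg; apply/funext => a; rewrite avgD //; exact: nice_section.
rewrite -avg2D //.
rewrite (_ : (fun a => _) =
  fun a => avg (fun b => (1 / 4 + U b a * h a) + (U a b * h b + c a b))); last first.
  by apply/funext => a; congr avg; apply/funext => b; exact: edgeE.
have nc4 : nice_kernel (fun _ _ : R => 1 / 4 : R) by exact: nice_cst.
rewrite avg2D; [|exact: niceD..].
rewrite (avg2D _ _ nc4 n1) (avg2D _ _ Uh_nice c_nice).
rewrite [X in avg X](_ : _ = fun=> 1 / 4); last by apply/funext => a; exact: avg_cst.
rewrite avg_cst cherry.
rewrite [X in _ + X + _](_ : _ = avg (fun a => h a * h a)); last first.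
  by rewrite avg_kernel_swap // -cherry.
rewrite [X in _ + (_ + X)](_ : _ = avg (fun a => h a * h a)); last first.
  rewrite -cherry; congr avg; apply/funext => a; rewrite /c.
  rewrite (avg_kernel_swap (k := fun b t => U a t * U b t)); last first.
    by apply: niceM; apply: nice_kernelP => //; exact: env_measurable_coord.
  congr avg; apply/funext => t; rewrite avgZ.
    by congr (_ * avg _); apply/funext => b; rewrite /U W_sym.
  exact: nice_section (nice_kernel_swap U_nice).
by have := cherry_ge0; lra.
Qed.

End Goodman.

(** * The inequality for kernels bounded away from 0 and 1 *)

Lemma positive_common (R : realType) (W : R -> R -> R) delta n (g : rel 'I_n) :
  triangle_tree g -> positive_kernel W delta ->
  positive_kernel (fun a b => 1 - W a b) delta ->
  2 / 2 ^+ e_count g <= mean n (edge_product W g) +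
    mean n (edge_product (fun a b => 1 - W a b) g).
Proof.
move=> tg pW pW'; have n0 := triangle_tree_gt0 tg.
have [k [e [ek cnt ex]]] := glued_measure_exists R tg.
have [nu [A [S gm]]] := ex _ _ pW.
have [nu' [A' [S' gm']]] := ex _ _ pW'.
have [nW Ws _ _] := pW; have [nW' _ _ _] := pW'.
have lb := glued_lower_bound nW n0 gm.
have lb' := glued_lower_bound nW' n0 gm'.
have gd := goodman nW Ws.
(* The edge densities of [W] and [1 - W] add up to 1, so they disappear from the summed bounds. *)
have pE : avg (fun a => avg (fun b => 1 - W a b)) = 1 - avg (fun a => avg (W a)).
  have nN : nice_kernel (fun a b => - W a b) by exact: niceN.
  rewrite -[X in X - _](avg_cst (1 : R)) -mulN1r -avgZ; last first.
    exact: nice_fun_bmeas (nice_integrate 1 nW).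
  rewrite -avgD; [|exact: bmeas_cst|]; last first.
    apply: bmeasM; first exact: bmeas_cst.
    exact: nice_fun_bmeas (nice_integrate 1 nW).
  congr avg; apply/funext => a.
  rewrite -[X in X + _](avg_cst (1 : R)) -avgZ; last exact: nice_section.
  rewrite -avgD; [|exact: bmeas_cst|]; last first.
    by apply: bmeasM; [exact: bmeas_cst|exact: nice_section].
  by congr avg; apply/funext => b; rewrite mulN1r.
rewrite pE in lb'.
set t := avg (vertex_density W) in lb gd; set t' := avg _ in lb' gd.
set T := mean _ _ in lb *; set T' := mean _ _ in lb' *.
set p := avg _ in lb lb'.
(* With Goodman's bound for the first term, [(k + 1) / 4 - 2 * (k - e) / 8 - e / 4 = 1 / 4]. *)
have sum : 2 ^+ e / 4 <= 8 ^+ k * (T + T').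
  rewrite mulrDr (le_trans _ (lerD lb lb')) // -mulrDr ler_pM2l ?exprn_gt0 //.
  have : k.+1%:R * (1 / 4) <= k.+1%:R * (t + t') by rewrite ler_pM2l ?ltr0n.
  by rewrite -natr1; lra.
(* From [e_count g + e = 3 * k.+1]; it makes [2 ^+ e / 4] equal to [8 ^+ k] times the target
   value. *)
have cntR : 2 ^+ e_count g * 2 ^+ e = 8 * 8 ^+ k :> R.
  by rewrite -exprD cnt exprM -exprS; congr (_ ^+ _); ring.
rewrite ler_pdivrMr ?exprn_gt0 //.
rewrite -(ler_pM2l (_ : 0 < 8 ^+ k :> R)) ?exprn_gt0 //.
apply: (@le_trans _ _ (2 ^+ e / 4 * 2 ^+ e_count g)); last first.
  by rewrite mulrA ler_pM2r ?exprn_gt0.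
by rewrite mulrAC [2 ^+ e * _]mulrC cntR; lra.
Qed.

(** * Homomorphism densities as iterated averages *)

Section IteratedIntegral.
Variable R : realType.

(** [x] holds the [m] variables fixed by the outer integrals; [y] holds the remaining ones,
    renumbered from 0 as in [iint]. *)
Definition prepend (m : nat) (x y : nat -> R) (k : nat) : R :=
  if (k < m)%N then x k else y (k - m)%N.

Lemma prepend_scons m x t y :
  prepend m x (scons t y) = prepend m.+1 (upd x m t) y.
Proof.
apply/funext => k; rewrite /prepend /upd ltnS [(k <= m)%N]leq_eqVlt.
case: eqVneq => [->|km] /=; first by rewrite ltnn subnn.
case: ltnP => // mk.
by have -> : (k - m = (k - m.+1).+1)%N by lia.
Qed.

(** Induction on the variables left. The zeros of [x] from [m] on match the null sequence in the
    base case of [iint]. *)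
Lemma iint_integrate_seq n m x (F : (nat -> R) -> R) :
  nice F -> (forall y, 0 <= F y) -> (forall k, (m <= k)%N -> x k = 0) ->
  iint n (fun y => (F (prepend m x y))%:E) = (integrate_seq (iota m n) F x)%:E.
Proof.
move=> nF F0; elim: n m x => [|n IH] m x x0 /=.
  congr (F _)%:E; apply/funext => k; rewrite /prepend.
  by case: ltnP => // mk; rewrite x0.
pose G t := integrate_seq (iota m.+1 n) F (upd x m t).
have bG : bmeas (R := R) G by exact: nice_upd (nice_integrate_seq _ nF).
have G0 t : (0 <= (G t)%:E)%E.
  rewrite lee_fin -(@integrate_seq_cst R (iota m.+1 n) 0 (upd x m t)).
  by apply: le_integrate_seq => //; exact: nice_cst.
transitivity (\int[lebesgue_measure]_(t in `[0%R, 1%R]%classic) (G t)%:E)%E.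
  apply: eq_integral => t _; rewrite /G -IH.
    by congr (iint n); apply/funext => y; rewrite prepend_scons.
  by move=> k mk; rewrite /upd gtn_eqF // x0 // ltnW.
rewrite -[RHS]/(avg G)%:E (avgE bG) integral_uniform //.
  by rewrite subr0 invr1 mul1e.
by apply/measurable_EFinP; case: bG.
Qed.

Lemma hom_densityE n (g : rel 'I_n) (W : R -> R -> R) :
  nice_kernel W -> (forall a b, 0 <= W a b) ->
  hom_density g W = (mean n (edge_product W g))%:E.
Proof.
move=> nW W0; rewrite -(@iint_integrate_seq n 0 (fun=> 0)) //.
- by congr (iint n); apply/funext => y; rewrite /edge_product; congr (_%:E);
    apply: eq_bigr => p _; rewrite /prepend /= !subn0.
- exact: nice_edge_product.
- by move=> y; apply: prodr_ge0.
Qed.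

End IteratedIntegral.

(** * Approximating a graphon by kernels bounded away from 0 and 1 *)

(** [C] is chosen before [w] and [d]: the error has to be linear in [d], uniformly in the
    weights. *)
Lemma prod_shift_le (R : realType) (I : Type) (r : seq I) (p : pred I) :
  exists2 C : R, 0 <= C & forall (w : I -> R) (d : R), 0 <= d <= 1 ->
    (forall i, 0 <= w i <= 1) ->
    \prod_(i <- r | p i) (w i + d) <= \prod_(i <- r | p i) w i + C * d.
Proof.
elim: r => [|i r [C C0 IH]].
  by exists 0 => // w d _ _; rewrite !big_nil mul0r addr0.
(* In the expansion of [(w i + d) * (Q + C * d)] the error terms are at most [C * d], [d] and
   [C * d]. *)
exists (2 * C + 1) => [|w d d01 w01]; first by rewrite addr_ge0 // mulr_ge0.
have := IH w d d01 w01; rewrite !big_cons.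
have Q0 : 0 <= \prod_(j <- r | p j) w j by apply: prodr_ge0 => j _; case/andP: (w01 j).
have Q1 : \prod_(j <- r | p j) w j <= 1 by apply: prodr_ile1.
move: (\prod_(j <- r | p j) (w j + d)) => P PQ.
have /andP[wi0 wi1] := w01 i; have /andP[d0 d1] := d01.
have Cd : 0 <= C * d by exact: mulr_ge0.
case: (p i); last by rewrite (le_trans PQ) // lerD2l; lra.
move: (\prod_(j <- r | p j) w j) Q0 Q1 PQ => Q Q0 Q1 PQ.
apply: (@le_trans _ _ ((w i + d) * (Q + C * d))).
  by rewrite ler_wpM2l // addr_ge0.
have h1 : w i * (C * d) <= C * d by rewrite ler_piMl.
have h2 : d * (C * d) <= C * d by rewrite ler_piMl.
have h3 : d * Q <= d by rewrite ler_piMr.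
by lra.
Qed.

Section Graphon.
Variables (R : realType) (W : R -> R -> R).
Hypothesis W_graphon : graphon W.

Lemma graphon_nice : nice_kernel W.
Proof.
have [mW _ W01] := W_graphon; split; last first.
  by exists 1 => x; have /andP[W0 W1] := W01 (x 0%N) (x 1%N); rewrite ger0_norm.
move=> d T c mc.
exact: (measurableT_comp mW (measurable_fun_pair (mc 0%N) (mc 1%N))).
Qed.

Lemma graphon_compl : graphon (fun a b => 1 - W a b).
Proof.
have [mW Ws W01] := W_graphon; split.
- by apply: measurable_funB.
- by move=> x y; rewrite Ws.
- by move=> x y; have /andP[W0 W1] := W01 x y; lra.
Qed.

(** Mixing with the constant 1/2 provides the floor [d / 2] for [W] and for [1 - W] alike. *)
Definition soften (d : R) a b : R := (1 - d) * W a b + d / 2.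

Lemma soften_positive d : 0 < d <= 1 -> positive_kernel (soften d) (d / 2).
Proof.
move=> /andP[d0 d1]; have [_ Ws W01] := W_graphon; split.
- apply: niceD; last exact: nice_cst.
  by apply: niceM; [exact: nice_cst|exact: graphon_nice].
- by move=> a b; rewrite /soften Ws.
- by rewrite divr_gt0.
- move=> a b; have /andP[W0 W1] := W01 a b.
  by rewrite /soften lerDr mulr_ge0 // subr_ge0.
Qed.

(** Pointwise [soften d] is at most [W + d], so the product estimate applies with a constant
    independent of [d]. *)
Lemma mean_soften n (g : rel 'I_n) : exists2 C : R, 0 <= C &
  forall d, 0 < d <= 1 ->
    mean n (edge_product (soften d) g) <= mean n (edge_product W g) + C * d.
Proof.
have [_ Ws W01] := W_graphon.
have [C C0 CP] := prod_shift_le R (index_enum _) (mem (edges g)).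
exists C => // d d01; have [nd _ _ dd] := soften_positive d01.
have /andP[d0 d1] := d01.
have dpos a b : 0 <= soften d a b by rewrite (le_trans _ (dd a b)) // divr_ge0 // ltW.
rewrite -[X in _ <= _ + X](integrate_seq_cst (iota 0 n) (C * d) (fun=> 0)).
rewrite -meanD; [|exact: nice_edge_product graphon_nice|exact: nice_cst].
apply: le_mean; first exact: nice_edge_product.
  by apply: niceD; [exact: nice_edge_product graphon_nice|exact: nice_cst].
move=> x; rewrite (le_trans _ (CP (fun p => W (x (val p.1)) (x (val p.2))) d _ _)) //.
- apply: ler_prod => p _; rewrite dpos /= /soften.
  have /andP[W0 W1] := W01 (x (val p.1)) (x (val p.2)).
  have : 0 <= d * W (x (val p.1)) (x (val p.2)) by rewrite mulr_ge0 // ltW.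
  by lra.
- by rewrite ltW.
Qed.

End Graphon.

Lemma soften_compl (R : realType) (W : R -> R -> R) d :
  soften (fun a b => 1 - W a b) d = fun a b => 1 - soften W d a b.
Proof. by apply/funext => a; apply/funext => b; rewrite /soften; field. Qed.

Theorem theorem1p1 (R : realType) (n : nat) (g : rel 'I_n) :
  triangle_tree g -> common R g.
Proof.
move=> tg W gW; have gW' := graphon_compl gW.
have [_ _ W01] := gW; have [_ _ W'01] := gW'.
rewrite /m_H !hom_densityE; last 4 first.
- exact: graphon_nice.
- by move=> a b; case/andP: (W'01 a b).
- exact: graphon_nice.
- by move=> a b; case/andP: (W01 a b).
rewrite -EFinD lee_fin.
have [C C0 CP] := mean_soften gW g.
have [C' C'0 CP'] := mean_soften gW' g.
have D0 : 0 < C + C' + 1 by rewrite ltr_wpDl // addr_ge0.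
apply/ler_addgt0Pr => e e0.
(* Chosen so that the total error [(C + C') * d] stays below [e]; the added 1 keeps the denominator
   positive, and the cap 1 is required by [soften_positive]. *)
pose d := Num.min 1 (e / (C + C' + 1)).
have d01 : 0 < d <= 1 by rewrite lt_min ltr01 divr_gt0 //= ge_min lexx.
have de : (C + C' + 1) * d <= e.
  by rewrite -ler_pdivlMl // mulrC ge_min lexx orbT.
have pW' := soften_positive gW' d01; rewrite soften_compl in pW'.
have := positive_common tg (soften_positive gW d01) pW'.
have := CP _ d01; have := CP' _ d01; rewrite soften_compl.
have /andP[d0 _] := d01.
by lra.
Qed.
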